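(* Let $A$ be a finite alphabet, $F_A$ the free group on $A$, and let $H\leqslant M_i\leqslant K\leqslant F_A$ be subgroups, for $i=1,2$. Write $\leqslant_{\mathrm{ont}}$ for onto extensions and $\leqslant_{\mathrm{f.ont}}$ for fully onto extensions. Then: (i) if $H\leqslant_{\mathrm{ont}} M_1\leqslant_{\mathrm{ont}} K$, then $H\leqslant_{\mathrm{ont}} K$; (ii) if $H\leqslant_{\mathrm{ont}} K$, then $M_1\leqslant_{\mathrm{ont}} K$, while in general $H\leqslant_{\mathrm{ont}} M_1$ need not hold; (iii) if $H\leqslant_{\mathrm{ont}} M_1$ and $H\leqslant_{\mathrm{ont}} M_2$, then $H\leqslant_{\mathrm{ont}}\langle M_1\cup M_2\rangle$, while in general $H\leqslant_{\mathrm{ont}} M_1\cap M_2$ need not hold; (i$'$) if $H\leqslant_{\mathrm{f.ont}} M_1\leqslant_{\mathrm{f.ont}} K$, then $H\leqslant_{\mathrm{f.ont}} K$; (ii$'$) if $H\leqslant_{\mathrm{f.ont}} K$, then $M_1\leqslant_{\mathrm{f.ont}} K$, while in general $H\leqslant_{\mathrm{f.ont}} M_1$ need not hold; (iii$'$) if $H\leqslant_{\mathrm{f.ont}} M_1$ and $H\leqslant_{\mathrm{f.ont}} M_2$, then $H\leqslant_{\mathrm{f.ont}}\langle M_1\cup M_2\rangle$, while in general $H\leqslant_{\mathrm{f.ont}} M_1\cap M_2$ need not hold. Here each ''in general ... need not hold'' means that there exist a finite alphabet $A$ and subgroups $H\leqslant M_i\leqslant K\leqslant F_A$ satisfying the hypothesis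 of that item for which the stated relation fails.
   Context: Stallings automata. Let $F$ be a free group with basis $C$. An involutive $C$-automaton is a directed graph (loops and parallel edges allowed) with edges labelled by elements of $C\cup C^{-1}$, with a distinguished vertex $\circledcirc$ (the basepoint), in which every edge $e$ from $p$ to $q$ labelled $c$ has an inverse edge $e^{-1}$ from $q$ to $p$ labelled $c^{-1}$. It is deterministic if no two different edges with the same label start (or end) at the same vertex. A path is reduced if it never crosses an edge immediately followed by its inverse. The automaton is trim if every vertex and edge appears in some reduced closed path at $\circledcirc$. A Stallings $C$-automaton is a connected, deterministic, trim involutive $C$-automaton. For each subgroup $H\leqslant F$ there is a unique (up to isomorphism) Stallings $C$-automaton $\Gamma_C(H)$ such that the set of labels of reduced closed paths at $\circledcirc$, read in $F$, is exactly $H$. A $C$-homomorphism between $C$-automata is a map sending vertices to vertices and edges to edges, preserving incidence, labels and basepoint. It is onto if it is surjective both on vertices and on edges. For $H\leqslant K\leqslant F$ there is a unique $C$-homomorphism $\theta_{H,K}\colon \Gamma_C(H)\to\Gamma_C(K)$. Let $H\leqslant K\leqslant F_A$. - $H\leqslant K$ is an onto extension if $\theta_{H,K}\colon\Gamma_{A'}(H)\to\Gamma_{A'}(K)$ is onto for every basis $A'$ of $F_A$. - $H\leqslant K$ is a fully onto extension if, for every (possibly infinite) alphabet $B\supseteq A$ and every basis $B'$ of $F_B\geqslant F_A$, $\theta_{H,K}\colon\Gamma_{B'}(H)\to\Gamma_{B'}(K)$ is onto. *)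

(* Defs.v *)
From HB Require Import structures.
From mathcomp Require Import all_boot.
From mathcomp Require Import boolp classical_sets functions.

Set Implicit Arguments.
Unset Strict Implicit.
Unset Printing Implicit Defensive.

Local Open Scope classical_set_scope.
Local Open Scope group_scope.

(* The letter [(x, false)] stands for [x] and [(x, true)] for its inverse. *)
Notation letter X := (X * bool)%type.

Definition linv (X : Type) (l : letter X) : letter X := (l.1, ~~ l.2).

Lemma linvK (X : Type) : involutive (@linv X).
Proof. by case=> x b; rewrite /linv /= negbK. Qed.

Section Words.
Variable X : choiceType.
Implicit Types (l m : letter X) (u v w : seq (letter X)).

Definition reduced w : bool := sorted (fun l m => m != linv l) w.

Definition push l w : seq (letter X) :=
  if w is m :: w' then if m == linv l then w' else l :: w else [:: l].

(* Free reduction. *)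
Definition reduce w : seq (letter X) := foldr push [::] w.

Lemma reduced_push l w : reduced w -> reduced (push l w).
Proof.
case: w => [//|m w] /=; case: ifPn => [_|ne] pw /=; last by rewrite ne.
exact: path_sorted pw.
Qed.

Lemma reduced_foldr u v : reduced v -> reduced (foldr push v u).
Proof. by move=> rv; elim: u => //= l u; apply: reduced_push. Qed.

Lemma reduced_reduce w : reduced (reduce w).
Proof. exact: reduced_foldr. Qed.

Lemma reduce_id w : reduced w -> reduce w = w.
Proof.
elim: w => [//|l [//|m w] IH] /andP[ne pw].
by rewrite -[LHS]/(push l (reduce (m :: w))) IH //= (negbTE ne).
Qed.

Lemma pushK l w : reduced w -> push l (push (linv l) w) = w.
Proof.
case: w => [|m w] /=; first by rewrite eqxx.
rewrite linvK; case: eqVneq => [->|ne]; last by rewrite /= eqxx.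
by case: w => [//|m' w] /= /andP[/negbTE -> _].
Qed.

Lemma foldr_reduce u v : reduced v -> foldr push v (reduce u) = foldr push v u.
Proof.
move=> rv; elim: u => //= l u <-.
case E: (reduce u) => [//|m w] /=; case: eqVneq => [->|//].
by rewrite pushK // reduced_foldr.
Qed.

Lemma reduce_catl u v : reduce (reduce u ++ v) = reduce (u ++ v).
Proof. by rewrite /reduce !foldr_cat foldr_reduce // reduced_reduce. Qed.

Lemma reduce_catr u v : reduce (u ++ reduce v) = reduce (u ++ v).
Proof.
by rewrite {1 3}/reduce !foldr_cat [foldr _ _ (reduce v)]reduce_id ?reduced_reduce.
Qed.

Definition winv w : seq (letter X) := rev (map (@linv X) w).

Lemma winvK : involutive winv.
Proof.
move=> w; rewrite /winv map_rev revK -map_comp map_id_in // => l _.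
exact: linvK.
Qed.

Lemma reduced_winv w : reduced w -> reduced (winv w).
Proof.
rewrite /reduced /winv rev_sorted sorted_map; apply: sub_sorted => l m /=.
by apply: contraNN => /eqP ->; rewrite !linvK.
Qed.

Lemma reduce_winvl w : reduce (winv w ++ w) = [::].
Proof.
elim: w => //= l w IH; rewrite /winv /= rev_cons cat_rcons -/(winv w).
rewrite -reduce_catr /= -/(reduce w) -{2}(linvK l) pushK ?reduced_reduce //.
by rewrite reduce_catr.
Qed.

Lemma reduce_winvr w : reduce (w ++ winv w) = [::].
Proof. by rewrite -{1}(winvK w) reduce_winvl. Qed.

Record freegroup := FreeGroup { fgword :> seq (letter X); _ : reduced fgword }.

HB.instance Definition _ := [isSub for fgword].
HB.instance Definition _ := [Choice of freegroup by <:].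

Implicit Types f g h : freegroup.

Lemma fgwordP f : reduced f. Proof. exact: (valP f). Qed.

Definition fg_mul f g : freegroup := FreeGroup (reduced_reduce (f ++ g)).
Definition fg_one : freegroup := @FreeGroup [::] isT.
Definition fg_inv f : freegroup := FreeGroup (reduced_winv (fgwordP f)).

Fact fg_mulA : associative fg_mul.
Proof. by move=> f g h; apply: val_inj; rewrite /= reduce_catl reduce_catr catA. Qed.
Fact fg_mul1g : left_id fg_one fg_mul.
Proof. by move=> f; apply: val_inj; rewrite /= reduce_id ?fgwordP. Qed.
Fact fg_mulg1 : right_id fg_one fg_mul.
Proof. by move=> f; apply: val_inj; rewrite /= cats0 reduce_id ?fgwordP. Qed.
Fact fg_mulVg : left_inverse fg_one fg_inv fg_mul.
Proof. by move=> f; apply: val_inj; rewrite /= reduce_winvl. Qed.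
Fact fg_mulgV : right_inverse fg_one fg_inv fg_mul.
Proof. by move=> f; apply: val_inj; rewrite /= reduce_winvr. Qed.

HB.instance Definition _ := isGroup.Build freegroup
  fg_mulA fg_mul1g fg_mulg1 fg_mulVg fg_mulgV.

Definition fg_gen (x : X) : freegroup := @FreeGroup [:: (x, false)] isT.

End Words.

Section Evaluation.
Variables (X : Type) (G : groupType) (x : X -> G).

Definition leval (l : letter X) : G := if l.2 then (x l.1)^-1 else x l.1.

Definition weval (w : seq (letter X)) : G := \prod_(l <- w) leval l.

End Evaluation.

(* The homomorphism from the free group on [X] extending [x]. *)
Definition fg_lift (X : choiceType) (G : groupType) (x : X -> G)
  (f : freegroup X) : G := weval x f.

(* The homomorphism [F_A -> F_B] induced by a map of alphabets. *)
Definition fg_map (A B : choiceType) (i : A -> B) : freegroup A -> freegroup B :=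
  fg_lift (fun a => fg_gen (i a)).

(* [C] is a basis of [G] when the canonical homomorphism to [G] from the free
   group on the set [C] is an isomorphism. *)
Definition basis (G : groupType) (C : set G) : Prop :=
  bijective (fg_lift (fun c : C => val c)).

Definition subgroup (G : groupType) (H : set G) : Prop := group_closed [in H].

Definition generated (G : groupType) (S : set G) : set G :=
  smallest (@subgroup G) S.

(* Involutive automata with labels in [X] and the formal inverses of its
   elements; [einv] is the inversion of edges. *)
Record automaton (X : Type) := Automaton {
  vertex : Type;
  edge : Type;
  base : vertex;
  src : edge -> vertex;
  tgt : edge -> vertex;
  lab : edge -> letter X;
  einv : edge -> edge;
  einvK : involutive einv;
  src_einv : forall e, src (einv e) = tgt e;
  tgt_einv : forall e, tgt (einv e) = src e;
  lab_einv : forall e, lab (einv e) = linv (lab e)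
}.

Section AutomatonProperties.
Variables (X : Type) (Gam : automaton X).

Fixpoint walk (p : vertex Gam) (s : seq (edge Gam)) (q : vertex Gam) : Prop :=
  if s is e :: s' then src e = p /\ walk (tgt e) s' q else p = q.

Definition reduced_walk (s : seq (edge Gam)) : Prop :=
  forall s1 e s2, s <> s1 ++ e :: einv e :: s2.

Definition reduced_loop (s : seq (edge Gam)) : Prop :=
  walk (base Gam) s (base Gam) /\ reduced_walk s.

Definition connected : Prop := forall p q, exists s, walk p s q.

Definition deterministic : Prop := forall e f : edge Gam, lab e = lab f ->
  src e = src f \/ tgt e = tgt f -> e = f.

Definition vertex_on_loop (p : vertex Gam) : Prop :=
  exists s1 s2, walk (base Gam) s1 p /\ reduced_loop (s1 ++ s2).

Definition edge_on_loop (e : edge Gam) : Prop :=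
  exists s1 s2, reduced_loop (s1 ++ e :: s2).

Definition trim : Prop :=
  (forall p, vertex_on_loop p) /\ (forall e, edge_on_loop e).

Definition stallings : Prop := [/\ connected, deterministic & trim].

End AutomatonProperties.

(* The set of labels of the reduced closed paths at the basepoint, read in the
   group by interpreting the letter [x] as [iota x]. *)
Definition recognized (X : Type) (G : groupType) (iota : X -> G)
    (Gam : automaton X) : set G :=
  [set g | exists2 s : seq (edge Gam),
     reduced_loop s & weval iota (map (@lab X Gam) s) = g].

(* [Gam] is (a model of) the Stallings [C]-automaton of [H]. *)
Definition stallings_of (G : groupType) (C H : set G) (Gam : automaton C) : Prop :=
  stallings Gam /\ recognized (fun c : C => val c) Gam = H.

Record automaton_hom (X : Type) (Gam Del : automaton X) := AutomatonHom {
  hvertex : vertex Gam -> vertex Del;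
  hedge : edge Gam -> edge Del;
  hom_base : hvertex (base Gam) = base Del;
  hom_src : forall e, src (hedge e) = hvertex (src e);
  hom_tgt : forall e, tgt (hedge e) = hvertex (tgt e);
  hom_lab : forall e, lab (hedge e) = lab e
}.

Definition onto_hom (X : Type) (Gam Del : automaton X)
    (theta : automaton_hom Gam Del) : Prop :=
  (forall q, exists p, hvertex theta p = q) /\
  (forall f, exists e, hedge theta e = f).

(* The Stallings automata of [H] and [K] are unique up to isomorphism and the
   homomorphism between them is unique, so quantifying over all of them only
   expresses independence of the chosen models; existence is [theta_exists]
   below. *)
Definition theta_onto (G : groupType) (C H K : set G) : Prop :=
  forall (Gam Del : automaton C) (theta : automaton_hom Gam Del),
    stallings_of H Gam -> stallings_of K Del -> onto_hom theta.

Definition onto_ext (A : choiceType) (H K : set (freegroup A)) : Prop :=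
  H `<=` K /\
  forall C : set (freegroup A), basis C -> theta_onto C H K.

(* An alphabet containing [A] is given by an injection [i : A -> B]. *)
Definition fully_onto_ext (A : choiceType) (H K : set (freegroup A)) : Prop :=
  H `<=` K /\
  forall (B : choiceType) (i : A -> B), injective i ->
  forall C : set (freegroup B), basis C ->
    theta_onto C (fg_map i @` H) (fg_map i @` K).

Definition intermediate_pair (G : groupType) (H M1 M2 K : set G) : Prop :=
  [/\ subgroup H, subgroup M1, subgroup M2 & subgroup K] /\
  [/\ H `<=` M1, M1 `<=` K, H `<=` M2 & M2 `<=` K].

Section Words2.
Variables (X : Type) (G : groupType) (x : X -> G).

Lemma leval_linv l : leval x (linv l) = (leval x l)^-1.
Proof. by case: l => a []; rewrite /leval /= ?invgK. Qed.

Lemma weval_nil : weval x [::] = 1.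
Proof. exact: big_nil. Qed.

Lemma weval_cons l w : weval x (l :: w) = leval x l * weval x w.
Proof. exact: big_cons. Qed.

Lemma weval_cat v w : weval x (v ++ w) = weval x v * weval x w.
Proof. exact: big_cat. Qed.

End Words2.

Section Walks.
Variables (X : Type) (Gam : automaton X).
Implicit Types (p q : vertex Gam) (e : edge Gam) (s : seq (edge Gam)).

Lemma walk_cat p q s1 s2 :
  walk p (s1 ++ s2) q <-> exists2 r, walk p s1 r & walk r s2 q.
Proof.
elim: s1 p => [|e s1 IH] p /=; first by split=> [|[r <-]//]; exists p.
split=> [[<- /IH[r ? ?]]|[r [<- ?] ?]]; first by exists r.
by split=> //; apply/IH; exists r.
Qed.

Definition walk_rev s : seq (edge Gam) := rev (map (@einv X Gam) s).

Lemma walk_revP p q s : walk p s q -> walk q (walk_rev s) p.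
Proof.
elim: s p => [|e s IH] p /=; first by move->.
move=> [<- /IH w]; rewrite /walk_rev /= rev_cons -cats1; apply/walk_cat.
by exists (tgt e) => //=; rewrite src_einv tgt_einv.
Qed.

Lemma walk_revK s : walk_rev (walk_rev s) = s.
Proof.
rewrite /walk_rev map_rev revK -map_comp -[RHS]map_id.
by apply: eq_map => e /=; rewrite einvK.
Qed.

Lemma walk_rev_cat s1 s2 : walk_rev (s1 ++ s2) = walk_rev s2 ++ walk_rev s1.
Proof. by rewrite /walk_rev map_cat rev_cat. Qed.

Lemma reduced_walk_rev s : reduced_walk s -> reduced_walk (walk_rev s).
Proof.
move=> rs s1 e s2 E; apply: (rs (walk_rev s2) e (walk_rev s1)).
rewrite -[LHS]walk_revK E walk_rev_cat /walk_rev /= !rev_cons einvK.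
by rewrite -!cats1 -!catA.
Qed.

Lemma reduced_loop_rev s : reduced_loop s -> reduced_loop (walk_rev s).
Proof. by case=> w r; split; [exact: walk_revP|exact: reduced_walk_rev]. Qed.

Lemma edge_on_loop_einv e : edge_on_loop e -> edge_on_loop (einv e).
Proof.
case=> s1 [s2 /reduced_loop_rev]; rewrite walk_rev_cat /walk_rev /= rev_cons.
by rewrite -cats1 -catA; exists (walk_rev s2), (walk_rev s1).
Qed.

Lemma vertex_on_loop_src e : edge_on_loop e -> vertex_on_loop (src e).
Proof.
case=> s1 [s2 l]; exists s1, (e :: s2); split=> //.
by case: l => /walk_cat[r w1 /= [-> _]].
Qed.

Lemma vertex_on_loop_tgt e : edge_on_loop e -> vertex_on_loop (tgt e).
Proof. by move=> /edge_on_loop_einv /vertex_on_loop_src; rewrite src_einv. Qed.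

Lemma vertex_on_loop_base : vertex_on_loop (base Gam).
Proof. by exists [::], [::]; split=> //; split=> // -[]. Qed.

End Walks.

Lemma lift_seq (T : Type) (P : T -> Prop) (s : seq T) :
  (forall s1 x s2, s = s1 ++ x :: s2 -> P x) ->
  exists s' : seq {x | P x}, map (fun x => proj1_sig x) s' = s.
Proof.
elim: s => [|x s IH] Ps; first by exists [::].
have [|s' <-] := IH; first by move=> s1 y s2 E; apply: (Ps (x :: s1) y s2); rewrite E.
by exists (exist _ x (Ps [::] x s erefl) :: s').
Qed.

(* The subautomaton of the vertices and edges lying on reduced closed paths at
   the basepoint. *)
Section Core.
Variables (X : Type) (Gam : automaton X).

Definition core_vertex := {p : vertex Gam | vertex_on_loop p}.
Definition core_edge := {e : edge Gam | edge_on_loop e}.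
Definition core_base : core_vertex := exist _ _ (vertex_on_loop_base Gam).
Definition core_src (e : core_edge) : core_vertex :=
  exist _ _ (vertex_on_loop_src (proj2_sig e)).
Definition core_tgt (e : core_edge) : core_vertex :=
  exist _ _ (vertex_on_loop_tgt (proj2_sig e)).
Definition core_einv (e : core_edge) : core_edge :=
  exist _ _ (edge_on_loop_einv (proj2_sig e)).

Fact core_einvK : involutive core_einv.
Proof. by case=> e ?; apply: eq_exist; rewrite /= einvK. Qed.
Fact core_src_einv e : core_src (core_einv e) = core_tgt e.
Proof. by apply: eq_exist; rewrite /= src_einv. Qed.
Fact core_tgt_einv e : core_tgt (core_einv e) = core_src e.
Proof. by apply: eq_exist; rewrite /= tgt_einv. Qed.

Definition core : automaton X :=
  Automaton core_base core_einvK core_src_einv core_tgt_einv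
    (fun e => lab_einv (proj1_sig e)).

Let sv (p : vertex core) : vertex Gam := proj1_sig p.
Let se (e : edge core) : edge Gam := proj1_sig e.

Lemma core_walk p s q : walk p s q <-> walk (sv p) (map se s) (sv q).
Proof.
elim: s p => [|e s IH] p /=.
  by split=> [->//|]; case: p q => [p p1] [q q1] E; apply: eq_exist.
split=> -[E w].
  by split; [rewrite -E|apply/(IH (core_tgt e))].
split; last exact/IH.
by case: p E => p p1 E; apply: eq_exist.
Qed.

Lemma core_loop s : reduced_loop s <-> reduced_loop (map se s).
Proof.
split=> -[w r]; (split; first exact/(core_walk (base core) s (base core)));
  move=> s1 e s2 E; last first.
  by apply: (r (map se s1) (se e) (map se s2)); rewrite E map_cat.
have E1 : map se (drop (size s1) s) = e :: einv e :: s2.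
  by rewrite map_drop E drop_size_cat.
case E2: (drop (size s1) s) E1 => [//|[a Pa] [//|[b Pb] t]] /= [Ea Eb _].
apply: (r (take (size s1) s) (exist _ a Pa) t).
rewrite -[LHS](cat_take_drop (size s1)) E2; do 2 f_equal.
by f_equal; apply: eq_exist; rewrite /= Eb Ea.
Qed.

Lemma loop_lift s : reduced_loop s ->
  exists2 s' : seq (edge core), reduced_loop s' & map se s' = s.
Proof.
move=> l; have [|s' E] := @lift_seq (edge Gam) (@edge_on_loop X Gam) s.
  by move=> s1 e s2 E; exists s1, s2; rewrite -E.
by exists s' => //; apply/core_loop; rewrite E.
Qed.

Lemma core_trim : trim core.
Proof.
split=> [[p Pp]|[e Pe]].
  have [s1 [s2 [w l2]]] := Pp; have [s l E] := loop_lift l2.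
  exists (take (size s1) s), (drop (size s1) s); rewrite cat_take_drop.
  by split=> //; apply/(core_walk (base core) _ (exist _ p Pp)); rewrite map_take E take_size_cat.
have [s1 [s2 l2]] := Pe; have [s l E] := loop_lift l2.
have E1 : map se (drop (size s1) s) = e :: s2 by rewrite map_drop E drop_size_cat.
case E2: (drop (size s1) s) E1 => [//|[a Pa] t] /= [Ea _].
exists (take (size s1) s), t; suff -> : exist _ e Pe = exist _ a Pa.
  by rewrite -E2 cat_take_drop.
exact: eq_exist.
Qed.

Lemma core_connected : connected core.
Proof.
have H p : exists s, walk (base core) s p.
  by have [s1 [s2 [w _]]] := core_trim.1 p; exists s1.
move=> p q; have [s1 w1] := H p; have [s2 w2] := H q.
exists (walk_rev s1 ++ s2); apply/walk_cat; exists (base core) => //.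
exact: walk_revP.
Qed.

Lemma core_deterministic : deterministic Gam -> deterministic core.
Proof.
move=> det [e Pe] [f Pf] L E; apply: eq_exist; apply: det => //.
by case: E => -[->]; [left|right].
Qed.

Lemma core_recognized (G : groupType) (iota : X -> G) :
  recognized iota core = recognized iota Gam.
Proof.
have L s : map (@lab X core) s = map (@lab X Gam) (map se s).
  by rewrite -map_comp.
apply/seteqP; split=> g [s].
  by move=> l; rewrite L => <-; exists (map se s) => //; apply/core_loop.
by move=> l2; have [s' l <-] := loop_lift l2; rewrite -L => <-; exists s'.
Qed.

End Core.

Lemma subgroupP (G : groupType) (H : set G) : subgroup H <->
  [/\ H 1, forall g, H g -> H g^-1 & forall g h, H g -> H h -> H (g * h)].
Proof.
split=> [sH|[H1 HV HM]].
  have HV := group_closedV sH; have HM := group_closedM sH.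
  split; first by have := sH.1; rewrite inE.
    by move=> g Hg; have := HV g; rewrite !inE; apply.
  by move=> g h Hg Hh; have := HM g h; rewrite !inE; apply.
split; first by rewrite inE.
by move=> g h; rewrite !inE => Hg Hh; apply/HM/HV.
Qed.

(* The involutive automaton whose vertices are all the subsets of [G], on which
   the letters act by right translation; its component at [H] is the Schreier
   graph of [H], so its core is the Stallings automaton. *)
Section Schreier.
Variables (G : groupType) (C : set G).

Let iota : C -> G := fun c => val c.

Definition rtrans (P : set G) (g : G) : set G := [set h | P (h * g^-1)].

Lemma rtrans1 P : rtrans P 1 = P.
Proof. by apply/seteqP; split=> h; rewrite /rtrans /= invg1 mulg1. Qed.

Lemma rtransM P g h : rtrans P (g * h) = rtrans (rtrans P g) h.
Proof. by apply/seteqP; split=> k; rewrite /rtrans /= invgM mulgA. Qed.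

Definition sch_edge : Type := (set G * letter C)%type.
Definition sch_src (e : sch_edge) : set G := e.1.
Definition sch_tgt (e : sch_edge) : set G := rtrans e.1 (leval iota e.2).
Definition sch_einv (e : sch_edge) : sch_edge := (sch_tgt e, linv e.2).

Fact sch_tgt_einv e : sch_tgt (sch_einv e) = sch_src e.
Proof.
by rewrite /sch_tgt /= leval_linv -rtransM mulgV rtrans1.
Qed.

Fact sch_einvK : involutive sch_einv.
Proof.
case=> P l; rewrite /sch_einv /= linvK; congr pair.
exact: (sch_tgt_einv (P, l)).
Qed.

Definition schreier (H : set G) : automaton C :=
  @Automaton C (set G) sch_edge H sch_src sch_tgt (fun e => e.2) sch_einv
    sch_einvK (fun _ => erefl) sch_tgt_einv (fun _ => erefl).

Fixpoint sch_walk (P : set G) (w : seq (letter C)) : seq sch_edge :=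
  if w is l :: w' then (P, l) :: sch_walk (rtrans P (leval iota l)) w' else [::].

Lemma sch_walkP H P s Q : walk (Gam := schreier H) P s Q ->
  Q = rtrans P (weval iota (map snd s)) /\ s = sch_walk P (map snd s).
Proof.
elim: s P => [|[P' l] s IH] P /=; first by move<-; rewrite weval_nil rtrans1.
move=> [<- /IH[-> E]]; rewrite weval_cons rtransM; split=> //.
by congr cons.
Qed.

Lemma walk_sch_walk H P w :
  walk (Gam := schreier H) P (sch_walk P w) (rtrans P (weval iota w)).
Proof.
elim: w P => [|l w IH] P /=; first by rewrite weval_nil rtrans1.
by split=> //; rewrite weval_cons rtransM; apply: IH.
Qed.

Lemma map_snd_sch_walk P w : map snd (sch_walk P w) = w.
Proof. by elim: w P => //= l w IH P; rewrite IH. Qed.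

Lemma reduced_sch_walk H P w :
  reduced w -> reduced_walk (Gam := schreier H) (sch_walk P w).
Proof.
move=> rw s1 e s2 /(congr1 (map snd)); rewrite map_snd_sch_walk map_cat /= => E.
by move: rw; rewrite E /reduced => /cat_sorted2[_] /=; rewrite eqxx.
Qed.

Lemma sch_deterministic H : deterministic (schreier H).
Proof.
move=> [P l] [Q m] /= <-; rewrite /sch_src /= => -[->//|E]; congr pair.
have := sch_tgt_einv (P, l); rewrite /sch_einv /= E => <-.
exact: (sch_tgt_einv (Q, l)).
Qed.

Lemma rtrans_subgroup H g : subgroup H -> rtrans H g = H <-> H g.
Proof.
move=> /subgroupP[H1 HV HM]; split=> [<-|Hg]; first by rewrite /rtrans /= mulgV.
apply/seteqP; split=> h; rewrite /rtrans /= => Hh; last exact/HM/HV.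
by rewrite -(mulgVK g h); apply: HM.
Qed.

Lemma core_schreierP H : basis C -> subgroup H ->
  stallings_of H (core (schreier H)).
Proof.
move=> bC sH; split.
  split; [exact: core_connected| |exact: core_trim].
  exact/core_deterministic/sch_deterministic.
rewrite core_recognized; apply/seteqP; split=> g.
  case=> s [/sch_walkP[E _] _] <-.
  by apply/(rtrans_subgroup _ sH); exact: esym E.
move=> Hg; have [u _ Ku] := bC.
exists (sch_walk H (u g)); last by rewrite map_snd_sch_walk; apply: Ku.
split; last exact/reduced_sch_walk/fgwordP.
have := @walk_sch_walk H H (fgword (u g)).
by rewrite [weval _ _]Ku (rtrans_subgroup _ sH).2.
Qed.

Definition lmulset (K P : set G) : set G :=
  [set g | exists2 k, K k & P (k^-1 * g)].

Lemma lmulset_sub H K : subgroup H -> subgroup K -> H `<=` K -> lmulset K H = K.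
Proof.
move=> /subgroupP[H1 _ _] /subgroupP[_ _ KM] HK; apply/seteqP; split=> g.
  by case=> k Kk /HK Kg; rewrite -(mulVKg k g); apply: KM.
by move=> Kg; exists g; rewrite // mulVg.
Qed.

Lemma lmulset_rtrans K P g : rtrans (lmulset K P) g = lmulset K (rtrans P g).
Proof.
by apply/seteqP; split=> h [k Kk Ph]; exists k => //; move: Ph;
  rewrite /rtrans /= mulgA.
Qed.

Definition schreier_hom H K (KH : lmulset K H = K) :
    automaton_hom (schreier H) (schreier K) :=
  @AutomatonHom C (schreier H) (schreier K)
    (lmulset K) (fun e => (lmulset K e.1, e.2)) KH
    (fun _ => erefl) (fun e => lmulset_rtrans K e.1 _) (fun _ => erefl).

End Schreier.

Section CoreHom.
Variables (X : Type) (Gam Del : automaton X) (theta : automaton_hom Gam Del).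
Hypothesis det : deterministic Gam.

Lemma hom_walk p s q :
  walk p s q -> walk (hvertex theta p) (map (hedge theta) s) (hvertex theta q).
Proof.
elim: s p => [|e s IH] p /=; first by move->.
by move=> [<- w]; rewrite hom_src hom_tgt; split=> //; apply: IH.
Qed.

Lemma hom_loop s : reduced_loop s -> reduced_loop (map (hedge theta) s).
Proof.
move=> [w r]; split; first by have := hom_walk w; rewrite hom_base.
move=> s1 f s2 E.
have : map (hedge theta) (drop (size s1) s) = f :: einv f :: s2.
  by rewrite map_drop E drop_size_cat.
case E2: (drop (size s1) s) => [//|a [//|b t]] /= [Ea Eb _].
move: w; rewrite -[s](cat_take_drop (size s1)) E2.
move=> /walk_cat[p _ [_ [S _]]].
apply: (r (take (size s1) s) a t).
rewrite -[LHS](cat_take_drop (size s1)) E2; do 3 f_equal.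
apply: det; last by left; rewrite src_einv.
by rewrite -(hom_lab theta) Eb -Ea !lab_einv hom_lab.
Qed.

Lemma hom_vertex_on_loop p : vertex_on_loop p -> vertex_on_loop (hvertex theta p).
Proof.
move=> [s1 [s2 [/hom_walk w /hom_loop l]]].
exists (map (hedge theta) s1), (map (hedge theta) s2).
by rewrite -map_cat; split=> //; rewrite -(hom_base theta).
Qed.

Lemma hom_edge_on_loop e : edge_on_loop e -> edge_on_loop (hedge theta e).
Proof.
move=> [s1 [s2 /hom_loop]]; rewrite map_cat /= => l.
by exists (map (hedge theta) s1), (map (hedge theta) s2).
Qed.

Definition core_hom : automaton_hom (core Gam) (core Del) :=
  @AutomatonHom X (core Gam) (core Del)
    (fun p => exist _ _ (hom_vertex_on_loop (proj2_sig p)))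
    (fun e => exist _ _ (hom_edge_on_loop (proj2_sig e)))
    (eq_exist _ _ (hom_base theta))
    (fun e => eq_exist _ _ (hom_src theta (proj1_sig e)))
    (fun e => eq_exist _ _ (hom_tgt theta (proj1_sig e)))
    (fun e => hom_lab theta (proj1_sig e)).

End CoreHom.

Lemma theta_exists (G : groupType) (C H K : set G) :
  basis C -> subgroup H -> subgroup K -> H `<=` K ->
  exists (Gam Del : automaton C) (theta : automaton_hom Gam Del),
    stallings_of H Gam /\ stallings_of K Del.
Proof.
move=> bC sH sK HK; exists (core (schreier C H)), (core (schreier C K)).
exists (core_hom (schreier_hom C (lmulset_sub sH sK HK)) (@sch_deterministic _ C H)).
by split; apply: core_schreierP.
Qed.

(* Main.v *)
(** The edge of the automaton of [K] at the vertex [K x] labelled [l] lies in the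
    image of the automaton of [H] iff some reduced word [v1 l v2] of [H] has
    [K v1 = K x].  The elements of [K] all of whose edges are so covered form a
    subgroup, which contains [s] as soon as [H] contains [s ^+ 2]; hence [H <= K]
    is fully onto when [K] is generated by elements with squares in [H].

    For the counterexamples take the free group on [a, b, c, d], [v = c a b a d],
    [H = <a^2, b^2, c^2, d^2, v^2>], [M1 = <H, a, b>] and [M2 = <H, c, d, v>].
    Then [H <= M1] and [H <= M2] are fully onto, but the edge labelled [b] read
    after [c c a] in [c v d = c^2 a b a d^2], an element of [M1] and [M2], is not
    covered by [H]. *)

From mathcomp Require Import all_boot fingroup perm.
From mathcomp Require Import boolp classical_sets functions.
Require Import Defs.

Set Implicit Arguments.
Unset Strict Implicit.
Unset Printing Implicit Defensive.

Local Open Scope classical_set_scope.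
Local Open Scope group_scope.

(** * Reduced words and cyclic reduction *)

Section ReducedWords.
Variable X : choiceType.
Implicit Types (l m : letter X) (u v w : seq (letter X)).

Lemma linv_neq l : l != linv l.
Proof. by case: l => x []; rewrite /linv /= xpair_eqE andbF. Qed.

Lemma reduced_catl u v : reduced (u ++ v) -> reduced u.
Proof. by move=> /cat_sorted2[]. Qed.

Lemma reduced_catr u v : reduced (u ++ v) -> reduced v.
Proof. by move=> /cat_sorted2[]. Qed.

(** Reducedness concerns adjacent letters, and the nonempty overlap [v] puts each adjacent pair
    inside [u ++ v] or [v ++ w]. *)
Lemma reduced_glue u v w :
  v <> [::] -> reduced (u ++ v) -> reduced (v ++ w) -> reduced (u ++ v ++ w).
Proof.
move=> v0; elim: u => // l [|m u] IH.
  by case: v v0 {IH} => // m v _ /= /andP[-> _].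
by move=> /andP[lm ruv] rvw; apply/andP; split=> //; exact: IH.
Qed.

Lemma winv_cat u v : winv (u ++ v) = winv v ++ winv u.
Proof. by rewrite /winv map_cat rev_cat. Qed.

(** Mutually inverse end letters are stripped off until the last and first letters no longer
    cancel. *)
Lemma cyclic_reduction w : reduced w -> w <> [::] ->
  exists u v, [/\ w = u ++ v ++ winv u, v <> [::] & reduced (v ++ v)].
Proof.
have [n] := ubnP (size w); elim: n w => // n IH [//|l w] /= szw rw _.
case/lastP: w szw rw => [|w m] szw rw.
  by exists [::], [:: l]; split; rewrite //= linv_neq.
have [E|ne] := eqVneq m (linv l); last first.
  exists [::], (l :: rcons w m); split; rewrite ?cats0 //.
  have -> : (l :: rcons w m) ++ l :: rcons w m
          = (l :: w) ++ [:: m] ++ (l :: rcons w m) by rewrite /= cat_rcons.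
  apply: reduced_glue => //; first by rewrite /= cats1.
  apply/andP; split; last exact: rw.
  by apply: contraNneq ne => ->; rewrite linvK.
subst m; have w0 : w <> [::] by move=> w0; move: rw; rewrite w0 /= eqxx.
have rw' : reduced w.
  by apply: (@reduced_catl _ [:: linv l]); rewrite cats1; exact: (@reduced_catr [:: l]).
case: (IH w) => // [|u [v [-> v0 rv]]]; first by rewrite size_rcons in szw; apply: ltnW.
exists (l :: u), v; split=> //.
by rewrite -[l :: u]cat1s winv_cat -cats1 /= -!catA.
Qed.

End ReducedWords.

(** * Evaluation of words in a group *)

Section Evaluation.
Variables (X : choiceType) (G : groupType) (iota : X -> G).
Implicit Types (l m : letter X) (u v w : seq (letter X)).

Lemma weval_winv w : weval iota (winv w) = (weval iota w)^-1.
Proof.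
elim: w => [|l w IH]; first by rewrite /winv weval_nil invg1.
by rewrite -cat1s winv_cat !weval_cat IH invgM !weval_cons !weval_nil !mulg1 leval_linv.
Qed.

Lemma weval_reduce w : weval iota (reduce w) = weval iota w.
Proof.
elim: w => // l w IH; rewrite weval_cons -IH /= -/(reduce w).
case: (reduce w) => [|m v] /=; first by rewrite weval_cons.
by case: eqVneq => [->|_]; rewrite !weval_cons // leval_linv mulVKg.
Qed.

Lemma fg_liftM : {morph fg_lift iota : f g / f * g}.
Proof. by move=> f g; rewrite /fg_lift -weval_cat -[RHS]weval_reduce. Qed.

Lemma fg_lift1 : fg_lift iota 1 = 1.
Proof. exact: weval_nil. Qed.

Lemma fg_liftV : {morph fg_lift iota : f / f^-1}.
Proof. by move=> f; rewrite /fg_lift -weval_winv. Qed.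

Lemma fg_lift_gen x : fg_lift iota (fg_gen x) = iota x.
Proof. by rewrite /fg_lift weval_cons weval_nil mulg1. Qed.

End Evaluation.

Lemma weval_gen (X : choiceType) (w : seq (letter X)) :
  fgword (weval (@fg_gen X) w) = reduce w.
Proof.
elim: w => [|l w IH]; first by rewrite weval_nil.
rewrite weval_cons -[LHS]/(reduce (leval (@fg_gen X) l ++ weval (@fg_gen X) w)).
by rewrite IH reduce_catr; case: l => x [].
Qed.

Lemma fg_lift_id (X : choiceType) : fg_lift (@fg_gen X) =1 id.
Proof. by move=> f; apply: val_inj; rewrite /= weval_gen reduce_id ?fgwordP. Qed.

(** * Generated subgroups *)

Section Generated.
Variables (G : groupType).
Implicit Types (S H : set G).

Lemma subgroup_generated S : subgroup (generated S).
Proof.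
apply/subgroupP; split=> [|g Sg|g h Sg Sh] H HP;
  have [/subgroupP[H1 HV HM] _] := HP => //.
  by apply: HV; exact: Sg H HP.
by apply: HM; [exact: Sg H HP|exact: Sh H HP].
Qed.

Lemma sub_generated S : S `<=` generated S.
Proof. by move=> g Sg H [_]; apply. Qed.

Lemma generated_sub S H : subgroup H -> S `<=` H -> generated S `<=` H.
Proof. by move=> sH SH g; apply. Qed.

Lemma subgroup_setI H S : subgroup H -> subgroup S -> subgroup (H `&` S).
Proof.
move=> /subgroupP[H1 HV HM] /subgroupP[S1 SV SM]; apply/subgroupP.
split=> [|g [Hg Sg]|g h [Hg Sg] [Hh Sh]]; split; by [|apply: HV|apply: SV|apply: HM|apply: SM].
Qed.

Lemma subgroup_setT : subgroup [set: G].
Proof. exact/subgroupP. Qed.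

End Generated.

(** * Images and preimages of subgroups *)

Section Lifting.
Variables (X : choiceType) (G : groupType) (iota : X -> G).
Implicit Types (S H : set (freegroup X)).

Lemma subgroup_image H : subgroup H -> subgroup (fg_lift iota @` H).
Proof.
move=> /subgroupP[H1 HV HM]; apply/subgroupP; split.
- by exists 1; rewrite ?fg_lift1.
- by move=> _ [f Hf <-]; exists f^-1; rewrite ?fg_liftV //; apply: HV.
- by move=> _ _ [f Hf <-] [g Hg <-]; exists (f * g); rewrite ?fg_liftM //; apply: HM.
Qed.

Lemma subgroup_preimage (K : set G) : subgroup K -> subgroup (fg_lift iota @^-1` K).
Proof.
move=> /subgroupP[K1 KV KM]; apply/subgroupP; split=> [|f|f g]; rewrite /preimage /=.
- by rewrite fg_lift1.
- by rewrite fg_liftV; apply: KV.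
- by rewrite fg_liftM; apply: KM.
Qed.

Lemma image_generated S :
  fg_lift iota @` generated S `<=` generated (fg_lift iota @` S).
Proof.
set T := (X in _ `<=` X); suff ST : generated S `<=` fg_lift iota @^-1` T.
  by move=> _ [f /ST Tf <-].
apply: generated_sub; first exact/subgroup_preimage/subgroup_generated.
by move=> f Sf; apply: sub_generated; exists f.
Qed.

End Lifting.

(** * Paths confined to a set of edges *)

Section Along.
Variables (X : choiceType) (G : groupType) (iota : X -> G).
Variable E : G -> letter X -> Prop.
Implicit Types (l m : letter X) (u v w : seq (letter X)) (x k : G).

(** Elements of [G] are the vertices of a graph on which letters act by right multiplication, and
    [E] is a set of its edges. *)
Fixpoint along x w : Prop :=
  if w is l :: w' then E x l /\ along (x * leval iota l) w' else True.

Lemma along_cat x u v :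
  along x (u ++ v) <-> along x u /\ along (x * weval iota u) v.
Proof.
elim: u x => [|l u IH] x /=; first by rewrite weval_nil mulg1; split=> [|[]].
by rewrite IH weval_cons mulgA; tauto.
Qed.

(** A cancelling pair returns to the vertex it left, so reduction only removes edges from the
    path. *)
Lemma along_reduce x w : along x w -> along x (reduce w).
Proof.
elim: w x => // l w IH x /= [Exl /IH]; rewrite -/(reduce w).
case: (reduce w) => [|m v] //=; case: eqVneq => [->|//].
by rewrite leval_linv mulgK => -[].
Qed.

Hypothesis Esym : forall x l, E x l -> E (x * leval iota l) (linv l).

Lemma along_winv x w : along x w -> along (x * weval iota w) (winv w).
Proof.
elim: w x => // l w IH x /= [/Esym Exl /IH].
rewrite -(cat1s l) winv_cat along_cat weval_cat weval_winv weval_cons weval_nil.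
by rewrite mulg1 mulgA mulgK.
Qed.

Variable K : set G.
Hypothesis sK : subgroup K.
Hypothesis EK : forall k x l, K k -> E x l -> E (k * x) l.

Lemma along_mull k x w : K k -> along x w -> along (k * x) w.
Proof.
move=> Kk; elim: w x => // l w IH x /= [Exl /IH].
by rewrite mulgA; split=> //; apply: EK.
Qed.

(** By [EK] the set [E] descends to the quotient by [K], where these words spell closed paths at the
    base vertex; such paths can be reversed and concatenated. *)
Lemma along_subgroup :
  subgroup [set k | K k /\ exists2 w, weval iota w = k & along 1 w].
Proof.
have [K1 KV KM] := (subgroupP K).1 sK; apply/subgroupP; split.
- by split=> //; exists [::]; rewrite ?weval_nil.
- move=> g [Kg [w Ew aw]]; split; first exact: KV.
  exists (winv w); first by rewrite weval_winv Ew.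
  have := along_mull (KV _ Kg) (along_winv aw).
  by rewrite mul1g -Ew mulVg.
- move=> g h [Kg [w Ew aw]] [Kh [v Ev av]]; split; first exact: KM.
  exists (w ++ v); first by rewrite weval_cat Ew Ev.
  apply/along_cat; split=> //; rewrite mul1g Ew.
  by rewrite -(mulg1 g); apply: along_mull.
Qed.

End Along.

(** * Edges covered by reduced words of a subgroup *)

Section Covers.
Variables (X : choiceType) (G : groupType) (iota : X -> G).
Implicit Types (l m : letter X) (u v w : seq (letter X)) (x k : G) (H K M : set G).

(* The edge with label [l] starting at the vertex [K x] of the automaton of [K]
   lies in the image of the automaton of [H]. *)
Definition covered H K x l : Prop := exists v1 v2,
  [/\ reduced (v1 ++ l :: v2), H (weval iota (v1 ++ l :: v2))
    & K (weval iota v1 * x^-1)].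

(** Reduced words of [K] trace exactly the edges of its trim automaton, so this is surjectivity on
    edges. *)
Definition covers H K : Prop := forall w,
  reduced w -> K (weval iota w) -> along iota (covered H K) 1 w.

Lemma along_sub (E E' : G -> letter X -> Prop) x w :
  (forall x l, E x l -> E' x l) -> along iota E x w -> along iota E' x w.
Proof. by move=> EE'; elim: w x => //= l w IH x [/EE' ? /IH]. Qed.

Lemma coveredP H K : covers H K <-> forall w1 l w2, reduced (w1 ++ l :: w2) ->
  K (weval iota (w1 ++ l :: w2)) -> covered H K (weval iota w1) l.
Proof.
split=> [HK w1 l w2 /HK /[apply] /along_cat[_ []]|cov w]; first by rewrite mul1g.
(* The prefix [p] already read is generalized, since it determines where the next edge starts. *)
suff H' p : reduced (p ++ w) -> K (weval iota (p ++ w)) ->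
    along iota (covered H K) (weval iota p) w.
  by have := H' [::]; rewrite weval_nil.
elim: w p => // l w IH p rw Kw /=; split; first exact: cov rw Kw.
rewrite -cat1s catA in rw Kw; have := IH _ rw Kw.
by rewrite weval_cat weval_cons weval_nil mulg1.
Qed.

Lemma covered_sub H M K x l : M `<=` K -> covered H M x l -> covered H K x l.
Proof. by move=> MK [v1 [v2 [r h m]]]; exists v1, v2; split=> //; apply: MK. Qed.

Lemma covers_refl H : subgroup H -> covers H H.
Proof.
move=> /subgroupP[H1 _ _]; apply/coveredP => w1 l w2 r h; exists w1, w2; split=> //.
by rewrite mulgV.
Qed.

(** The word of [M] covering an edge has its own edge covered by a word of [H]; the coset conditions
    compose because [M] lies in [K]. *)
Lemma covers_trans H M K :
  subgroup K -> M `<=` K -> covers H M -> covers M K -> covers H K.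
Proof.
move=> /subgroupP[_ _ KM] MK /coveredP HM /coveredP MKc; apply/coveredP=> w1 l w2 r k.
have [v1 [v2 [rv mv kv]]] := MKc _ _ _ r k.
have [u1 [u2 [ru hu mu]]] := HM _ _ _ rv mv.
exists u1, u2; split=> //; rewrite -(divgKA (weval iota v1)).
by apply: KM => //; apply: MK.
Qed.

Lemma covers_intermediate H M K : H `<=` M -> covers H K -> covers M K.
Proof.
move=> HM /coveredP HK; apply/coveredP=> w1 l w2 r k.
have [v1 [v2 [rv hv kv]]] := HK _ _ _ r k.
by exists v1, v2; split=> //; apply: HM.
Qed.

Section Subgroup.
Variables H K : set G.
Hypotheses (sH : subgroup H) (sK : subgroup K) (HK : H `<=` K).

(** The inverse of the covering word crosses the inverse edge; the two coset conditions differ by a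
    factor from [H]. *)
Lemma covered_linv x l : covered H K x l -> covered H K (x * leval iota l) (linv l).
Proof.
have [_ HV _] := (subgroupP H).1 sH; have [_ _ KM] := (subgroupP K).1 sK.
move=> [v1 [v2 [r h k]]]; exists (winv v2), (winv v1).
have -> : winv v2 ++ linv l :: winv v1 = winv (v1 ++ l :: v2).
  by rewrite winv_cat -(cat1s l v2) winv_cat -catA.
split; [exact: reduced_winv|by rewrite weval_winv; apply: HV|].
suff -> : weval iota (winv v2) * (x * leval iota l)^-1
        = (weval iota (v1 ++ l :: v2))^-1 * (weval iota v1 * x^-1).
  by apply: KM => //; apply/HK/HV.
by rewrite weval_winv weval_cat weval_cons !invgM !mulgA mulgVK.
Qed.

Lemma covered_mull k x l : K k -> covered H K x l -> covered H K (k * x) l.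
Proof.
have [_ KV KM] := (subgroupP K).1 sK.
move=> Kk [v1 [v2 [r h Kx]]]; exists v1, v2; split=> //.
by rewrite invgM mulgA; apply/KM/KV.
Qed.

Hypothesis iota_basis : bijective (fg_lift iota).

Lemma weval_inj v w : reduced v -> reduced w -> weval iota v = weval iota w -> v = w.
Proof.
move=> rv rw E; have := bij_inj iota_basis (x1 := FreeGroup rv) (x2 := FreeGroup rw) E.
by move/(congr1 (@fgword X)).
Qed.

(** The elements of [K] with some covered spelling form a subgroup containing [S]; reducing such a
    spelling keeps it covered and yields the unique reduced one. *)
Lemma covers_generated (S : set G) :
  K `<=` generated S -> S `<=` K ->
  (forall s, S s -> exists2 w, weval iota w = s & along iota (covered H K) 1 w) ->
  covers H K.
Proof.
move=> KS SK cS w rw Kw.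
have sA := along_subgroup covered_linv sK covered_mull.
have [|_ [v E /along_reduce av]] := generated_sub sA _ (KS _ Kw).
  by move=> s Ss; split; [exact: SK|exact: cS].
by have <- : reduce v = w
  by apply: weval_inj => //; [exact: reduced_reduce|rewrite weval_reduce].
Qed.

Lemma ex_reduced g : exists2 w, reduced w & weval iota w = g.
Proof. by have [u _ uK] := iota_basis; exists (u g); [apply: fgwordP|apply: uK]. Qed.

Lemma covers_join (M1 M2 : set G) :
  M1 `<=` K -> M2 `<=` K -> K `<=` generated (M1 `|` M2) ->
  covers H M1 -> covers H M2 -> covers H K.
Proof.
move=> MK1 MK2 KM c1 c2; apply: (covers_generated KM).
  by rewrite subUset.
move=> s Ms; have [w rw E] := ex_reduced s; exists w => //.
subst s; have [/c1 a|/c2 a] := Ms; apply: (along_sub _ (a rw)) => x l;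
  exact: covered_sub.
Qed.

(* If [w = u v u^-1] with [v] cyclically reduced, then [w ^+ 2] is spelled by the
   reduced word [u v v u^-1], which crosses all the edges crossed by [w]. *)
Lemma covers_roots (S : set G) :
  K `<=` generated S -> S `<=` K -> (forall s, S s -> H (s * s)) -> covers H K.
Proof.
move=> KS SK Ssq; apply: (covers_generated KS SK) => s Ss.
have [_ KV _] := (subgroupP K).1 sK.
have [w rw E] := ex_reduced s; exists w => //.
have [->//|/eqP w0] := eqVneq w [::].
have [u [v [Ew v0 rv]]] := cyclic_reduction rw w0; subst w.
have rW : reduced (u ++ v ++ v ++ winv u).
  apply: reduced_glue => //; first by apply: reduced_catl; rewrite -catA; exact: rw.
  by apply: reduced_glue => //; exact: reduced_catr rw.
have EW : weval iota (u ++ v ++ v ++ winv u) = s * s.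
  by rewrite -E !weval_cat weval_winv !mulgA mulgVK.
(* A reduced word of [H] covers its own edges. *)
have: along iota (covered H K) 1 (u ++ v ++ v ++ winv u).
  apply: (along_sub (E := covered H H)); first by move=> x l; apply: covered_sub.
  by apply: covers_refl => //; rewrite EW; apply: Ssq.
move=> /along_cat[au /along_cat[av /along_cat[_ aw]]].
apply/along_cat; split=> //; apply/along_cat; split=> //.
(* The tail [winv u] was read after [u v v]; left translation by the inverse of [s], an element of
   [K], makes it start after [u v]. *)
have := along_mull covered_mull (KV _ (SK _ Ss)) aw.
rewrite -E !weval_cat weval_winv !invgM !invgK !mul1g !mulgA.
by rewrite !mulgVK.
Qed.

End Subgroup.
End Covers.

(** * Walks in deterministic automata and their labels *)

Section Walks.
Variables (X : choiceType) (Gam : automaton X).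
Hypothesis det : deterministic Gam.
Implicit Types (p q r : vertex Gam) (s t : seq (edge Gam)).

Lemma walk_lab_inj p q r s t :
  walk p s q -> walk p t r -> map (@lab X Gam) s = map (@lab X Gam) t ->
  s = t /\ q = r.
Proof.
elim: s p t => [|e s IH] p [|f t] //=; first by move=> <- <-.
move=> [Ee ws] [Ef wt] [L Ls].
have ef : e = f by apply: det => //; left; rewrite Ee Ef.
by subst f; have [-> ->] := IH _ _ ws wt Ls.
Qed.

(** If consecutive labels are inverse, determinism makes the second edge the inverse of the
    first. *)
Lemma reduced_lab p q s :
  walk p s q -> reduced_walk s -> reduced (map (@lab X Gam) s).
Proof.
elim: s p => // e [//|f s] IH p [_ ws] rs; apply/andP; split.
  apply/negP => /eqP L; apply: (rs [::] e s); congr [:: _, _ & _].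
  apply: det; first by rewrite lab_einv.
  by left; rewrite src_einv; case: ws.
by apply: (IH _ ws) => s1 g s2 E; apply: (rs (e :: s1) g s2); rewrite E.
Qed.

Variables (G : groupType) (iota : X -> G).

Lemma walk_reduce p q s : walk p s q -> exists s',
  [/\ walk p s' q, reduced_walk s' &
      weval iota (map (@lab X Gam) s') = weval iota (map (@lab X Gam) s)].
Proof.
have [n] := ubnP (size s); elim: n s => // n IH s sz ws.
have [rs|/existsNP[s1 /existsNP[e /existsNP[s2 /contrapT E]]]] := pselect (reduced_walk s).
  by exists s.
subst s; move: ws => /walk_cat[r w1 /= [Er [_ w2]]]; subst r.
have [||s' [w' r' E']] := IH (s1 ++ s2).
- by move: sz; rewrite !size_cat /= !addnS !ltnS => /ltnW.
- by apply/walk_cat; exists (src e) => //; rewrite -tgt_einv.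
exists s'; split=> //; rewrite E' !map_cat !weval_cat /= !weval_cons lab_einv.
by rewrite leval_linv mulVKg.
Qed.

End Walks.

(** * Surjectivity of the homomorphism as a condition on words *)

Section ThetaOnto.
Variables (G : groupType) (C H K : set G).
Hypotheses (basisC : basis C) (sH : subgroup H) (sK : subgroup K).
Let iota : C -> G := fun c => val c.

Section Stallings.
Variables (M : set G) (Gam : automaton C).
Hypotheses (sM : subgroup M) (GamM : stallings_of M Gam).
Let det : deterministic Gam. Proof. by case: GamM => -[]. Qed.
Let recM : recognized iota Gam = M. Proof. by case: GamM. Qed.

(** The recognizing loop has a reduced label with the value of [w], hence equal to [w] because [C]
    is a basis. *)
Lemma stallings_loop w : reduced w -> M (weval iota w) ->
  exists2 s, reduced_loop s & map (@lab C Gam) s = w.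
Proof.
rewrite -recM => rw [s ls E]; exists s => //.
by apply: (weval_inj basisC) => //; case: ls => ws; apply: reduced_lab ws.
Qed.

Lemma loop_mem s : walk (base Gam) s (base Gam) ->
  M (weval iota (map (@lab C Gam) s)).
Proof.
by move=> /(walk_reduce iota)[t [wt rt <-]]; rewrite -recM; exists t.
Qed.

(** Prefixing [t] by a loop whose value is the given element of [M] gives a walk with the value of
    [s]; after reduction the two labels agree, hence so do the ends. *)
Lemma walk_coset p q s t :
  walk (base Gam) s p -> walk (base Gam) t q ->
  M (weval iota (map (@lab C Gam) s) * (weval iota (map (@lab C Gam) t))^-1) ->
  p = q.
Proof.
move=> /(walk_reduce iota)[s' [ws rs <-]] wt; rewrite -recM => -[u [wu _] E].
have wut : walk (base Gam) (u ++ t) q by apply/walk_cat; exists (base Gam).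
have [t' [wt' rt']] := walk_reduce iota wut.
rewrite map_cat weval_cat [weval _ (map _ u)]E mulgVK => Et.
have L : map (@lab C Gam) t' = map (@lab C Gam) s'.
  by apply: (weval_inj basisC) Et; [apply: reduced_lab wt' _|apply: reduced_lab ws _].
by have [] := walk_lab_inj det wt' ws L.
Qed.

End Stallings.

Lemma map_cat_cons (S T : Type) (f : S -> T) s t1 y t2 :
  map f s = t1 ++ y :: t2 -> exists s1 x s2,
  [/\ s = s1 ++ x :: s2, map f s1 = t1, f x = y & map f s2 = t2].
Proof.
elim: t1 s => [|z t1 IH] [|x s] //= [<-]; first by move=> <-; exists [::], x, s.
by move=> /IH[s1 [x' [s2 [-> <- <- <-]]]]; exists (x :: s1), x', s2.
Qed.

Lemma covers_theta_onto : covers iota H K -> theta_onto C H K.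
Proof.
move=> /coveredP HK Gam Del theta GamH DelK.
have [[_ detD [vD eD]] recK] := DelK.
have onE f : exists e, hedge theta e = f.
  have [s1 [s2 [ws rs]]] := eD f.
  have rl := reduced_lab detD ws rs; rewrite map_cat /= in rl.
  have Kl := loop_mem DelK ws; rewrite map_cat /= in Kl.
  have [v1 [v2 [rv Hv Kv]]] := HK _ _ _ rl Kl.
  have [t [wt _] Et] := stallings_loop GamH rv Hv.
  have [t1 [e [t2 [Ett Et1 Ele _]]]] := map_cat_cons Et.
  (* By determinism only the sources remain to be compared, and [Kv] puts them in the same coset. *)
  exists e; apply: detD; first by rewrite hom_lab.
  left; rewrite hom_src; move: wt; rewrite Ett => /walk_cat[p w1 /= [Ep _]].
  move: ws => /walk_cat[q w2 /= [-> _]]; rewrite Ep.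
  have := hom_walk theta w1; rewrite hom_base => w1'.
  apply: (walk_coset DelK w1' w2).
  by rewrite -map_comp (eq_map (hom_lab theta)) Et1.
(* A vertex is the basepoint or the target of the last edge on a walk to it, so edges suffice. *)
split=> // q; have [s1 [s2 [ws _]]] := vD q.
case/lastP: s1 ws => [<-|s1 f]; first by exists (base Gam); exact: hom_base.
rewrite -cats1 => /walk_cat[r _ /= [_ <-]]; have [e <-] := onE f.
by exists (tgt e); rewrite hom_tgt.
Qed.

(** [theta_exists] supplies models to instantiate [theta_onto]; a reduced loop through a preimage of
    the edge then spells the covering word. *)
Lemma theta_onto_covers : H `<=` K -> theta_onto C H K -> covers iota H K.
Proof.
move=> HK; have [Gam [Del [theta [GamH DelK]]]] := theta_exists basisC sH sK HK.
move=> /(_ Gam Del theta GamH DelK)[_ onE]; apply/coveredP => w1 l w2 rw Kw.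
have [s [ws _] Es] := stallings_loop DelK rw Kw.
have [s1 [f [s2 [Ess Es1 Elf _]]]] := map_cat_cons Es.
have [e Ee] := onE f; subst f.
have [[_ detG [_ eG]] recH] := GamH.
have [t1 [t2 [wt rt]]] := eG e.
exists (map (@lab C Gam) t1), (map (@lab C Gam) t2).
have El : lab e = l by rewrite -Elf hom_lab.
have := reduced_lab detG wt rt; have := loop_mem GamH wt.
rewrite map_cat /= El => Ht rl; split=> //.
move: ws; rewrite Ess => /walk_cat[q w1' /= [Eq _]].
move: wt => /walk_cat[p w2' /= [Ep _]].
have := hom_walk theta w2'; rewrite hom_base -Ep -hom_src Eq => w3.
(* The image of [t1] followed by [s1] reversed is closed at the basepoint, which gives the coset
   condition. *)
have := @loop_mem K Del DelK _ ((walk_cat _ _ _ _).2 (ex_intro2 _ _ q w3 (walk_revP w1'))).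
rewrite map_cat weval_cat -map_comp (eq_map (hom_lab theta)).
suff -> : map (@lab C Del) (walk_rev s1) = winv w1 by rewrite weval_winv.
rewrite /walk_rev /winv map_rev -map_comp -Es1 -map_comp.
by congr rev; apply: eq_map => a /=; rewrite lab_einv.
Qed.

Lemma theta_ontoP : H `<=` K -> theta_onto C H K <-> covers iota H K.
Proof. by move=> HK; split; [exact: theta_onto_covers|exact: covers_theta_onto]. Qed.

End ThetaOnto.

(** * Permanence properties for a fixed basis *)

Section Extensions.
Variables (G : groupType) (C : set G).
Hypothesis basisC : basis C.
Implicit Types H K M S : set G.

Lemma theta_onto_trans H M K :
  subgroup H -> subgroup M -> subgroup K -> H `<=` M -> M `<=` K ->
  theta_onto C H M -> theta_onto C M K -> theta_onto C H K.
Proof.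
move=> sH sM sK HM MK /(theta_ontoP basisC sH sM HM) c1 /(theta_ontoP basisC sM sK MK) c2.
apply/(theta_ontoP basisC sH sK); first exact: subset_trans MK.
exact: covers_trans c2.
Qed.

Lemma theta_onto_intermediate H M K :
  subgroup H -> subgroup M -> subgroup K -> H `<=` M -> M `<=` K ->
  theta_onto C H K -> theta_onto C M K.
Proof.
move=> sH sM sK HM MK /(theta_ontoP basisC sH sK (subset_trans HM MK)) c.
by apply/(theta_ontoP basisC sM sK MK); apply: covers_intermediate c.
Qed.

Lemma theta_onto_join H M1 M2 K :
  subgroup H -> subgroup M1 -> subgroup M2 -> subgroup K ->
  H `<=` M1 -> H `<=` M2 -> M1 `<=` K -> M2 `<=` K ->
  K `<=` generated (M1 `|` M2) ->
  theta_onto C H M1 -> theta_onto C H M2 -> theta_onto C H K.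
Proof.
move=> sH sM1 sM2 sK HM1 HM2 MK1 MK2 KM.
move=> /(theta_ontoP basisC sH sM1 HM1) c1 /(theta_ontoP basisC sH sM2 HM2) c2.
have HK := subset_trans HM1 MK1.
by apply/(theta_ontoP basisC sH sK HK); exact: covers_join MK1 MK2 KM c1 c2.
Qed.

Lemma theta_onto_roots H K S :
  subgroup H -> subgroup K -> H `<=` K ->
  K `<=` generated S -> S `<=` K -> (forall s, S s -> H (s * s)) ->
  theta_onto C H K.
Proof.
move=> sH sK HK KS SK Ssq; apply/(theta_ontoP basisC sH sK HK).
exact: covers_roots KS SK Ssq.
Qed.

End Extensions.

Lemma fully_onto_ext_onto (A : choiceType) (H K : set (freegroup A)) :
  fully_onto_ext H K -> onto_ext H K.
Proof.
move=> [HK f]; split=> // C bC; have := f A id (fun _ _ => id) C bC.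
have -> : fg_map id = id :> (freegroup A -> _) by apply/funext/fg_lift_id.
by rewrite !image_id.
Qed.

(** Squares lying in [H] are preserved by [fg_map], so the square criterion applies for every
    alphabet and basis. *)
Lemma fully_onto_ext_roots (A : choiceType) (H S : set (freegroup A)) :
  subgroup H -> H `<=` generated S -> (forall s, S s -> H (s * s)) ->
  fully_onto_ext H (generated S).
Proof.
move=> sH HS Ssq; split=> // B i _ C bC; rewrite /fg_map.
apply: (@theta_onto_roots _ _ bC _ _ (fg_map i @` S)).
- exact: subgroup_image.
- exact/subgroup_image/subgroup_generated.
- exact: image_subset.
- exact: image_generated.
- by apply: image_subset; exact: sub_generated.
- by move=> _ [s Ss <-]; exists (s * s); [exact: Ssq|exact: fg_liftM].
Qed.

(** * The standard basis *)

Section StandardBasis.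
Variable A : choiceType.

Definition std_basis : set (freegroup A) := range (@fg_gen A).

Lemma std_basis_mem a : fg_gen a \in std_basis.
Proof. by rewrite inE; exists a. Qed.

Definition std_gen (a : A) : std_basis := SigSub (std_basis_mem a).

Lemma fg_lift_weval (X : choiceType) (G : groupType) (x : X -> G)
    (Y : Type) (y : Y -> freegroup X) w :
  fg_lift x (weval y w) = weval (fg_lift x \o y) w.
Proof.
elim: w => [|l w IH]; first by rewrite !weval_nil fg_lift1.
rewrite !weval_cons fg_liftM IH; congr (_ * _).
by case: l => a [] //=; rewrite /leval /= fg_liftV.
Qed.

Lemma basis_std : basis std_basis.
Proof.
exists (fg_lift (fun a => fg_gen (std_gen a))) => f.
  rewrite fg_lift_weval -[RHS]fg_lift_id; congr weval; apply/funext => c /=.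
  have [a _ E] := set_valP c; rewrite -E fg_lift_gen; congr fg_gen.
  exact/val_inj.
rewrite fg_lift_weval -[RHS]fg_lift_id; congr weval; apply/funext => a /=.
by rewrite fg_lift_gen.
Qed.

End StandardBasis.

Arguments std_basis : clear implicits.

(** * Permutation actions and stabilizers *)

Section Action.
Variables (A : choiceType) (T : finType) (rho : A -> {perm T}) (t0 : T).

(** Permutations compose from left to right, so [f] is read from its first letter as a path from
    [t0]. *)
Definition endpoint (f : freegroup A) : T := fg_lift rho f t0.

Lemma endpointM f g : endpoint (f * g) = fg_lift rho g (endpoint f).
Proof. by rewrite /endpoint fg_liftM permM. Qed.

Lemma subgroup_stabilizer : subgroup [set f | endpoint f = t0].
Proof.
apply/subgroupP; split=> [|f|f g]; rewrite /= ?endpointM.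
- by rewrite /endpoint fg_lift1 perm1.
- by rewrite /endpoint fg_liftV => {1}<-; rewrite permK.
- by move=> ->.
Qed.

End Action.

Lemma fg_gen_inj (X : choiceType) : injective (@fg_gen X).
Proof. by move=> x y /(congr1 (@fgword X)) []. Qed.

(** * Positive words and actions by involutions *)

Section PositiveWords.
Variable A : choiceType.
Implicit Types (u v w : seq A).

Definition pos w : freegroup A := \prod_(a <- w) fg_gen a.

Lemma pos_cat v w : pos (v ++ w) = pos v * pos w.
Proof. exact: big_cat. Qed.

Definition std_word w : seq (letter (std_basis A)) := [seq (std_gen a, false) | a <- w].

Lemma weval_std_word w : weval (fun c : std_basis A => val c) (std_word w) = pos w.
Proof. by rewrite /weval big_map. Qed.

Lemma reduced_std_word w : reduced (std_word w).
Proof.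
by elim: w => [//|a [//|b w] IH]; rewrite /= xpair_eqE andbF.
Qed.

Variables (T : finType) (f : A -> T -> T) (fK : forall a, involutive (f a)).

Definition inv_perm a : {perm T} := perm (inv_inj (@fK a)).

Lemma fg_lift_leval (l : letter (std_basis A)) a t : val l.1 = fg_gen a ->
  fg_lift inv_perm (leval (fun c : std_basis A => val c) l) t = f a t.
Proof.
case: l => c [] /= E; rewrite /leval /= E ?fg_liftV fg_lift_gen; last by rewrite permE.
by apply: (@perm_inj _ (inv_perm a)); rewrite permKV permE fK.
Qed.

Lemma endpoint_pos t v : endpoint inv_perm t (pos v) = foldl (fun s a => f a s) t v.
Proof.
elim/last_ind: v => [|v a IH]; first by rewrite /pos big_nil /endpoint fg_lift1 perm1.
rewrite -cats1 foldl_cat /= -IH pos_cat endpointM /pos big_seq1 fg_lift_gen.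
by rewrite permE.
Qed.

End PositiveWords.

(** * The counterexample *)

Section Counterexample.

Definition alphabet : finType := (bool * bool)%type.
Definition a : alphabet := (false, false).
Definition b : alphabet := (false, true).
Definition c : alphabet := (true, false).
Definition d : alphabet := (true, true).
Definition v : seq alphabet := [:: c; a; b; a; d].

Definition words (U : seq (seq alphabet)) : set (freegroup alphabet) :=
  generated (@pos alphabet @` [set` U]).

Definition squares : seq (seq alphabet) :=
  [seq w ++ w | w <- [:: [:: a]; [:: b]; [:: c]; [:: d]; v]].
Definition roots1 : seq (seq alphabet) := [:: [:: a]; [:: b]].
Definition roots2 : seq (seq alphabet) := [:: [:: c]; [:: d]; v].

Definition exH := words squares.
Definition exM1 := words (roots1 ++ squares).
Definition exM2 := words (roots2 ++ squares).

(** The generators of [exM1] fix [(false, false)] under this action; those of [exM2] fix [None]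
    under [act2]. *)
Definition act1 (x : alphabet) (s : bool * bool) : bool * bool :=
  if x == c then (~~ s.1, s.2) else if x == d then (s.1, ~~ s.2) else s.

(* [a] exchanges [None] and [Some false], [b] exchanges [None] and [Some true]. *)
Definition act2 (x : alphabet) (s : option bool) : option bool :=
  if x.1 then s else
  match s with
  | None => Some x.2
  | Some y => if y == x.2 then None else s
  end.

Lemma act1K x : involutive (act1 x).
Proof. by case: x => [[] []] [[] []]. Qed.

Lemma act2K x : involutive (act2 x).
Proof. by case: x => [[] []] [[]|]. Qed.

Notation rho1 := (inv_perm act1K).
Notation rho2 := (inv_perm act2K).
Notation end1 := (endpoint rho1 (false, false)).
Notation end2 := (endpoint rho2 None).

Lemma words_stabilizer (T : finType) (f : alphabet -> T -> T)
    (fK : forall x, involutive (f x)) (t : T) (U : seq (seq alphabet)) :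
  all (fun w => foldl (fun s x => f x s) t w == t) U ->
  words U `<=` [set g | endpoint (inv_perm fK) t g = t].
Proof.
move=> /allP Ut; apply: generated_sub; first exact: subgroup_stabilizer.
by move=> _ [w Uw <-]; rewrite /= endpoint_pos; apply/eqP/Ut.
Qed.

Lemma words_sub U V : {subset U <= V} -> words U `<=` words V.
Proof.
move=> UV; apply: generated_sub; first exact: subgroup_generated.
by move=> _ [w Uw <-]; apply: sub_generated; exists w => //; apply: UV.
Qed.

Lemma pos_words w U : w \in U -> words U (pos w).
Proof. by move=> Uw; apply: sub_generated; exists w. Qed.

Lemma exH_sub1 : exH `<=` exM1.
Proof. by apply: words_sub => w; rewrite mem_cat orbC => ->. Qed.

Lemma exH_sub2 : exH `<=` exM2.
Proof. by apply: words_sub => w; rewrite mem_cat orbC => ->. Qed.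

Lemma exH_roots U : all (fun w => w ++ w \in squares) U ->
  fully_onto_ext exH (words (U ++ squares)).
Proof.
move=> /allP Usq; have sH : subgroup exH by exact: subgroup_generated.
apply: fully_onto_ext_roots => //.
  by apply: words_sub => w; rewrite mem_cat orbC => ->.
move=> _ [w + <-]; rewrite /= mem_cat => /orP[/Usq/pos_words|/pos_words wsq].
  by rewrite pos_cat.
by have [_ _ HM] := (subgroupP _).1 sH; apply: HM.
Qed.

(* The edges of the Schreier graph of the stabilizer of [(false, false), None],
   except the loop labelled [b] at [(false, false), Some false]. *)
Definition allowed (g : freegroup alphabet) (l : letter (std_basis alphabet)) : Prop :=
  ~~ [&& val l.1 == fg_gen b, end1 g == (false, false) & end2 g == Some false].

(** Computable form of [along] with [allowed] for positive words, the group element being replaced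
    by its two endpoints. *)
Fixpoint avoids s t (w : seq alphabet) : bool :=
  if w is x :: w' then
    ~~ [&& x == b, s == (false, false) & t == Some false] &&
    avoids (act1 x s) (act2 x t) w'
  else true.

Notation val_std := (fun x : std_basis alphabet => val x).

Lemma avoids_along g w : avoids (end1 g) (end2 g) w ->
  along val_std allowed g (std_word w).
Proof.
elim: w g => [|x w IH] g; first by split.
move=> /andP[ok av]; split; first by rewrite /allowed (inj_eq (@fg_gen_inj _)).
have Ex : val (std_gen x, false).1 = fg_gen x by [].
by apply: IH; rewrite !endpointM !(fg_lift_leval _ _ Ex).
Qed.

(** The excluded edge is a loop, and [allowed] treats a letter and its inverse alike. *)
Lemma allowed_linv g l : allowed g l -> allowed (g * leval val_std l) (linv l).
Proof.
rewrite /allowed /=; case: eqP => //= E; rewrite !endpointM !(fg_lift_leval _ _ E).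
by case: (end1 g) => [[] []]; case: (end2 g) => [[]|].
Qed.

Lemma exH_along w : reduced w -> exH (weval val_std w) -> along val_std allowed 1 w.
Proof.
set K := [set g | end1 g = (false, false)] `&` [set g | end2 g = None].
have sK : subgroup K by apply: subgroup_setI; exact: subgroup_stabilizer.
have allowed_mull k g l : K k -> allowed g l -> allowed (k * g) l.
  by move=> [k1 k2]; rewrite /allowed !endpointM [end1 k]k1 [end2 k]k2.
have HK : exH `<=` K.
  by rewrite subsetI; split;
    [exact: (@words_stabilizer _ _ act1K (false, false) squares isT)
    |exact: (@words_stabilizer _ _ act2K None squares isT)].
move=> rw Hw.
have [|_ [u E /along_reduce au]] :=
    generated_sub (along_subgroup allowed_linv sK allowed_mull) _ Hw.
  move=> _ [u Uu <-]; split; first by apply: HK; exact: pos_words.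
  exists (std_word u); first exact: weval_std_word.
  apply: avoids_along; rewrite /endpoint !fg_lift1 !perm1.
  (* A boolean computation on the five squares. *)
  by move: u Uu; apply/allP.
have <- // : reduce u = w.
by apply: (weval_inj (@basis_std alphabet)) => //;
  [exact: reduced_reduce|rewrite weval_reduce].
Qed.

Lemma exH_not_onto : ~ onto_ext exH (exM1 `&` exM2).
Proof.
have sM : subgroup (exM1 `&` exM2) by apply: subgroup_setI; exact: subgroup_generated.
have sH : subgroup exH by exact: subgroup_generated.
have HM : exH `<=` exM1 `&` exM2.
  by rewrite subsetI; split; [exact: exH_sub1|exact: exH_sub2].
move=> [_ /(_ _ (@basis_std alphabet))/(theta_ontoP (@basis_std _) sH sM HM)/coveredP].
move=> /(_ (std_word [:: c; c; a]) (std_gen b, false) (std_word [:: a; d; d])).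
rewrite -[_ ++ _]/(std_word ([:: c] ++ v ++ [:: d])) !weval_std_word => cov.
have [||v1 [v2 [rv Hv [Mv1 Mv2]]]] := cov.
- exact: reduced_std_word.
- split; last first.
    have [_ _ HMul] := (subgroupP exM2).1 (subgroup_generated _).
    by rewrite !pos_cat; apply: (HMul); [|apply: HMul];
      apply: (@pos_words _ (roots2 ++ squares)).
  have [_ _ HMul] := (subgroupP exM1).1 (subgroup_generated _).
  (* Regrouped this way, the word is a product of generators of [exM1]. *)
  rewrite -[_ ++ _]/(([:: c] ++ [:: c]) ++ [:: a] ++ [:: b] ++ [:: a] ++ ([:: d] ++ [:: d])).
  by do 4 (rewrite pos_cat; apply: (HMul); first by apply: (@pos_words _ (roots1 ++ squares)));
    apply: (@pos_words _ (roots1 ++ squares)).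
set g := weval _ v1 in Mv1 Mv2.
(* Since [g] and [c c a] lie in the same right coset of [exM1] and of [exM2], they have the same
   endpoints, so the edge [b] after [g] is the excluded loop. *)
have e1 : end1 g = (false, false).
  have E := @words_stabilizer _ _ act1K (false, false) (roots1 ++ squares) isT _ Mv1.
  by rewrite -(divgK (pos [:: c; c; a]) g) endpointM [endpoint _ _ _]E -/(end1 _) endpoint_pos.
have e2 : end2 g = Some false.
  have E := @words_stabilizer _ _ act2K None (roots2 ++ squares) isT _ Mv2.
  by rewrite -(divgK (pos [:: c; c; a]) g) endpointM [endpoint _ _ _]E -/(end2 _) endpoint_pos.
have /along_cat[_ [+ _]] := exH_along rv Hv.
by rewrite mul1g /allowed e1 e2 !eqxx.
Qed.

End Counterexample.

(** * The closure properties and their failures *)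

Theorem proposition3p6 :
  (* (i) *)
  (forall (A : finType) (H M1 M2 K : set (freegroup A)),
     intermediate_pair H M1 M2 K ->
     onto_ext H M1 -> onto_ext M1 K -> onto_ext H K) /\
  (* (ii) *)
  ((forall (A : finType) (H M1 M2 K : set (freegroup A)),
      intermediate_pair H M1 M2 K ->
      onto_ext H K -> onto_ext M1 K) /\
   (exists (A : finType) (H M1 M2 K : set (freegroup A)),
      [/\ intermediate_pair H M1 M2 K, onto_ext H K & ~ onto_ext H M1])) /\
  (* (iii) *)
  ((forall (A : finType) (H M1 M2 K : set (freegroup A)),
      intermediate_pair H M1 M2 K ->
      onto_ext H M1 -> onto_ext H M2 -> onto_ext H (generated (M1 `|` M2))) /\
   (exists (A : finType) (H M1 M2 K : set (freegroup A)),
      [/\ intermediate_pair H M1 M2 K, onto_ext H M1, onto_ext H M2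
        & ~ onto_ext H (M1 `&` M2)])) /\
  (* (i') *)
  (forall (A : finType) (H M1 M2 K : set (freegroup A)),
     intermediate_pair H M1 M2 K ->
     fully_onto_ext H M1 -> fully_onto_ext M1 K -> fully_onto_ext H K) /\
  (* (ii') *)
  ((forall (A : finType) (H M1 M2 K : set (freegroup A)),
      intermediate_pair H M1 M2 K ->
      fully_onto_ext H K -> fully_onto_ext M1 K) /\
   (exists (A : finType) (H M1 M2 K : set (freegroup A)),
      [/\ intermediate_pair H M1 M2 K, fully_onto_ext H K
        & ~ fully_onto_ext H M1])) /\
  (* (iii') *)
  ((forall (A : finType) (H M1 M2 K : set (freegroup A)),
      intermediate_pair H M1 M2 K ->
      fully_onto_ext H M1 -> fully_onto_ext H M2 ->
      fully_onto_ext H (generated (M1 `|` M2))) /\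
   (exists (A : finType) (H M1 M2 K : set (freegroup A)),
      [/\ intermediate_pair H M1 M2 K, fully_onto_ext H M1, fully_onto_ext H M2
        & ~ fully_onto_ext H (M1 `&` M2)])).
Proof.
have sG := @subgroup_generated.
have sI (A B : choiceType) (i : A -> B) (H : set (freegroup A)) :
  subgroup H -> subgroup (fg_map i @` H) by exact: subgroup_image.
have ex_pair K : subgroup K -> exM1 `<=` K -> exM2 `<=` K ->
    intermediate_pair exH exM1 exM2 K.
  move=> sK M1K M2K; split; split=> //; try exact: sG.
  - exact: exH_sub1.
  - exact: exH_sub2.
have ont1 : fully_onto_ext exH exM1 by exact: (@exH_roots roots1).
have ont2 : fully_onto_ext exH exM2 by exact: (@exH_roots roots2).
(* For (ii) and (ii') the intersection is the intermediate subgroup and [exM1] is the top. *)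
have pairI : intermediate_pair exH (exM1 `&` exM2) exM1 exM1.
  split; split=> //; try exact: sG; try exact: exH_sub1; try exact: subIsetl.
    exact: subgroup_setI (sG _ _) (sG _ _).
  by rewrite subsetI; split; [exact: exH_sub1|exact: exH_sub2].
have pairT := ex_pair _ (subgroup_setT _) (@subsetT _ _) (@subsetT _ _).
split=> [A H M1 M2 K [[sH s1 s2 sK] [H1 K1 H2 K2]] [_ o1] [_ o2]|].
  by split=> [|C bC]; [exact: subset_trans K1|apply: (theta_onto_trans bC _ s1); auto].
split.
  split=> [A H M1 M2 K [[sH s1 s2 sK] [H1 K1 H2 K2]] [_ o]|].
    by split=> // C bC; apply: (theta_onto_intermediate bC sH); auto.
  exists alphabet, exH, (exM1 `&` exM2), exM1, exM1; split=> //.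
  - exact: fully_onto_ext_onto.
  - exact: exH_not_onto.
split.
  split=> [A H M1 M2 K [[sH s1 s2 sK] [H1 K1 H2 K2]] [_ o1] [_ o2]|].
    have [J1 J2] : M1 `<=` generated (M1 `|` M2) /\ M2 `<=` generated (M1 `|` M2).
      by rewrite -subUset; exact: sub_generated.
    split=> [|C bC]; first exact: subset_trans J1.
    by apply: (theta_onto_join bC _ s1 s2); auto.
  exists alphabet, exH, exM1, exM2, [set: _]; split=> //.
  - exact: fully_onto_ext_onto.
  - exact: fully_onto_ext_onto.
  - exact: exH_not_onto.
split=> [A H M1 M2 K [[sH s1 s2 sK] [H1 K1 H2 K2]] [_ o1] [_ o2]|].
  split=> [|B i ii C bC]; first exact: subset_trans K1.
  by apply: (theta_onto_trans bC (sI _ _ _ _ sH) (sI _ _ _ _ s1) (sI _ _ _ _ sK));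
    auto; try exact: image_subset.
split.
  split=> [A H M1 M2 K [[sH s1 s2 sK] [H1 K1 H2 K2]] [_ o]|].
    split=> // B i ii C bC.
    apply: (theta_onto_intermediate bC (sI _ _ _ _ sH) (sI _ _ _ _ s1) (sI _ _ _ _ sK));
      auto; try exact: image_subset.
  exists alphabet, exH, (exM1 `&` exM2), exM1, exM1; split=> //.
  (* Failure over [A] itself already refutes the fully onto relation. *)
  by move=> /fully_onto_ext_onto; exact: exH_not_onto.
split=> [A H M1 M2 K [[sH s1 s2 sK] [H1 K1 H2 K2]] [_ o1] [_ o2]|].
  have [J1 J2] : M1 `<=` generated (M1 `|` M2) /\ M2 `<=` generated (M1 `|` M2).
    by rewrite -subUset; exact: sub_generated.
  split=> [|B i ii C bC]; first exact: subset_trans J1.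
  apply: (theta_onto_join bC (sI _ _ _ _ sH) (sI _ _ _ _ s1) (sI _ _ _ _ s2)
    (sI _ _ _ _ (sG _ _))); auto; try exact: image_subset.
  by rewrite -image_setU; exact: image_generated.
exists alphabet, exH, exM1, exM2, [set: _]; split=> //.
by move=> /fully_onto_ext_onto; exact: exH_not_onto.
Qed.
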